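(* Let $p\in\mathcal{S}$. Then the following statements hold. (i) There exists a constant $L>0$ such that $$|x^{p(x)}-y^{p(y)}|\le L|x-y|\quad\text{for all }x,y\in(0,\infty).$$ (ii) There exists a constant $K>0$ such that $$x^{p(x)}\le K(1+x)\quad\text{for all }x\in(0,\infty).$$
   Context: The class $\mathcal{S}$ consists of all functions $p:(0,\infty)\to\mathbb{R}$ satisfying the following three conditions. (1) $p$ is differentiable, $1\le p^-:=\inf_{x>0}p(x)$ and $p^+:=\sup_{x>0}p(x)<\infty$. (2) $\lim_{x\to\infty}p(x)=1$ and $\limsup_{x\to\infty}(p(x)-1)\log(x)<\infty$. (3) There exist real numbers $\delta,M_0,C_0>0$ and $\alpha>0$ with $p^+<1+\alpha$ such that $|p'(x)|\le M_0$ for $0<x\le\delta$ and $|p'(x)|\le C_0x^{-1-\alpha}$ for $x>\delta$. *)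

(* Defs.v *)
From HB Require Import structures.
From mathcomp Require Import all_boot all_order all_algebra.
From mathcomp Require Import all_classical all_reals all_analysis.
Set Implicit Arguments.
Unset Strict Implicit.
Unset Printing Implicit Defensive.
Import Order.TTheory GRing.Theory Num.Theory.
Import numFieldNormedType.Exports.
Local Open Scope classical_set_scope.
Local Open Scope ring_scope.

(* An exponent p : (0, oo) -> R is represented by a total function R -> R of
   which only the values on (0, oo) matter: no notion below depends on the
   values of p at nonpositive arguments. *)
Definition p_minus (R : realType) (p : R -> R) : \bar R :=
  ereal_inf [set (p x)%:E | x in `]0, +oo[].

Definition p_plus (R : realType) (p : R -> R) : \bar R :=
  ereal_sup [set (p x)%:E | x in `]0, +oo[].

Record class_S (R : realType) (p : R -> R) : Prop := ClassS {
  class_S_derivable : forall x : R, 0 < x -> derivable p x 1 ;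
  class_S_inf : (1%:E <= p_minus p)%E ;
  class_S_sup : (p_plus p < +oo)%E ;
  class_S_cvg : p x @[x --> +oo] --> (1 : R) ;
  class_S_limsup :
    (limf_esup (fun x : R => ((p x - 1) * ln x)%:E) (pinfty_nbhs R)
       < +oo)%E ;
  class_S_derive :
    exists delta M0 C0 alpha : R,
      [/\ [/\ 0 < delta, 0 < M0, 0 < C0 & 0 < alpha],
          (p_plus p < (1 + alpha)%:E)%E,
          forall x : R, 0 < x -> x <= delta -> `|derive1 p x| <= M0 &
          forall x : R, delta < x -> `|derive1 p x| <= C0 * x `^ (- 1 - alpha)]
}.

(* Main.v *)
(* Since (p(x) - 1) log x is bounded above on (0, oo) -- it is nonpositive on
   (0, 1], bounded on compact intervals because p is, and bounded near infinity
   by the limsup condition -- one has x^p(x) <= E x for some E, which gives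
   (ii).  The derivative of x^p(x) is x^(p(x) - 1) (x p'(x) log x + p(x)); its
   first factor is at most E, and x p'(x) log x is bounded by
   |log x| <= x + 1/x near 0 and by the same inequality applied to x^alpha away
   from 0.  The mean value theorem then gives (i). *)
Require Import Defs.
From HB Require Import structures.
From mathcomp Require Import all_boot all_order all_algebra.
From mathcomp Require Import all_classical all_reals all_analysis.
From mathcomp Require Import ring lra.
Import Order.TTheory GRing.Theory Num.Theory.
Import numFieldNormedType.Exports.
Set Implicit Arguments.
Unset Strict Implicit.
Unset Printing Implicit Defensive.
Local Open Scope classical_set_scope.
Local Open Scope ring_scope.

(** Apply [ln t < t] at both [x] and [x^-1]; the logarithms are opposite. *)
Lemma norm_ln_le (R : realType) (x : R) : 0 < x -> `|ln x| <= x + x^-1.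
Proof.
move=> x0; have xV0 : 0 < x^-1 by rewrite invr_gt0.
have := ln_sublinear x0; have := ln_sublinear xV0.
by rewrite lnV ?posrE// ler_norml => ? ?; apply/andP; split; lra.
Qed.

Lemma mulr_norm_ln_le (R : realType) (d x : R) : 0 < x -> x <= d ->
  x * `|ln x| <= d ^+ 2 + 1.
Proof.
move=> x0 xd; apply: (@le_trans _ _ (x * (x + x^-1))).
  by rewrite ler_pM2l// norm_ln_le.
by rewrite mulrDr divff ?gt_eqF// -expr2 lerD2r ler_sqr ?nnegrE; lra.
Qed.

(** With [u = x]^ a[,]ln u = a * ln x[, so]norm_ln_le[at]u[bounds the product by]a^-1 * (1 + u ^-
    2)[, and]u >= d [^ a]. *)
Lemma powRN_norm_ln_le (R : realType) (a d x : R) : 0 < a -> 0 < d -> d <= x ->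
  x `^ (- a) * `|ln x| <= a^-1 * (1 + (d `^ a) ^- 2).
Proof.
move=> a0 d0 dx; have x0 : 0 < x by exact: lt_le_trans dx.
have u0 : 0 < x `^ a by exact: powR_gt0.
have v0 : 0 < d `^ a by exact: powR_gt0.
have vu : d `^ a <= x `^ a by apply: ge0_ler_powR; rewrite ?nnegrE; lra.
have -> : `|ln x| = a^-1 * `|ln (x `^ a)|.
  by rewrite ln_powR normrM gtr0_norm// mulrA mulVf ?gt_eqF// mul1r.
rewrite powRN mulrCA ler_pM2l ?invr_gt0//.
apply: (@le_trans _ _ ((x `^ a)^-1 * (x `^ a + (x `^ a)^-1))).
  by rewrite ler_pM2l ?invr_gt0// norm_ln_le.
rewrite mulrDr mulVf ?gt_eqF// lerD2l -expr2 exprVn lef_pV2 ?posrE ?exprn_gt0//.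
by rewrite ler_sqr ?nnegrE// ltW.
Qed.

Lemma bounded_derive_lipschitz (R : realType) (f df : R -> R) (C : R) :
  (forall x : R, 0 < x -> is_derive x 1 f (df x)) ->
  (forall x : R, 0 < x -> `|df x| <= C) ->
  forall x y : R, 0 < x -> 0 < y -> `|f x - f y| <= C * `|x - y|.
Proof.
move=> fdf dfC; suff H (x y : R) : 0 < x -> x <= y ->
    `|f x - f y| <= C * `|x - y|.
  move=> x y x0 y0; have [xy|/ltW yx] := leP x y; first exact: H.
  by rewrite distrC (distrC x); exact: H.
move=> x0 xy; rewrite distrC (distrC x).
have [||c] := @MVT_segment R f df x y xy.
- by move=> z; rewrite in_itv/= => /andP[xz _]; apply: fdf; exact: lt_trans xz.
- apply: derivable_within_continuous => z; rewrite in_itv/= => /andP[xz _].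
  have zf := fdf z (lt_le_trans x0 xz); exact: ex_derive.
rewrite in_itv/= => /andP[xc _] ->; rewrite normrM ler_wpM2r//.
by apply: dfC; exact: lt_le_trans xc.
Qed.

Section class_S_theory.
Variables (R : realType) (p : R -> R).
Hypothesis hp : class_S p.

Lemma class_S_ge1 (x : R) : 0 < x -> 1 <= p x.
Proof.
move=> x0; rewrite -lee_fin; apply: (le_trans (class_S_inf hp)).
by apply: ereal_inf_lbound; exists x => //=; rewrite in_itv/= x0.
Qed.

Lemma class_S_le : exists2 a : R, 0 < a & forall x, 0 < x -> p x <= 1 + a.
Proof.
have [d [M0 [C0 [a [[_ _ _ a0] pa _ _]]]]] := class_S_derive hp.
exists a => // x x0; rewrite -lee_fin; apply: le_trans (ltW pa).
by apply: ereal_sup_ubound; exists x => //=; rewrite in_itv/= x0.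
Qed.

Lemma class_S_log_near_pinfty : exists N B : R, forall x, N < x ->
  (p x - 1) * ln x <= B.
Proof.
have [_ [V [N [_ NV]] <-] supV] := ereal_inf_lt (class_S_limsup hp).
have [B supB] : exists B : R,
    (ereal_sup [set ((p x - 1) * ln x)%:E | x in V] <= B%:E)%E.
  (* A supremum below +oo is real or -oo; in the latter case any real bounds it. *)
  by case: ereal_sup supV => // [r _|_]; [exists r | exists 0; exact: leNye].
exists N, B => x Nx; rewrite -lee_fin; apply: le_trans supB.
by apply: ereal_sup_ubound; exists x => //; exact: NV.
Qed.

Lemma class_S_log_bounded : exists D : R, forall x, 0 < x ->
  (p x - 1) * ln x <= D.
Proof.
have [a a0 pa] := class_S_le; have [N [B NB]] := class_S_log_near_pinfty.
have lnM0 : 0 <= ln (Num.max N 1) by rewrite ln_ge0// le_max lexx orbT.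
(* [B] serves [x > N]; the second term serves [1 < x <= N], where [p x - 1 <= a]. The absolute value
   and the maximum keep both terms nonnegative, so the sum also covers [x <= 1]. *)
exists (`|B| + a * ln (Num.max N 1)) => x x0.
have p1 := class_S_ge1 x0; have pxa := pa x x0.
have aM0 : 0 <= a * ln (Num.max N 1) by rewrite mulr_ge0// ltW.
have B0 := normr_ge0 B; have [x1|x1] := leP x 1.
  have : (p x - 1) * ln x <= 0 by rewrite mulr_ge0_le0 ?ln_le0//; lra.
  by lra.
have [xN|Nx] := leP x N; last first.
  by have := NB x Nx; have := ler_norm B; lra.
have : (p x - 1) * ln x <= a * ln (Num.max N 1).
  apply: ler_pM; [lra | by rewrite ln_ge0// ltW | lra |].
  by rewrite ler_ln ?posrE ?le_max ?lt_max ?ltr01 ?orbT ?xN.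
by lra.
Qed.

Lemma class_S_powR_le : exists2 E : R, 0 < E & forall x, 0 < x ->
  x `^ p x <= E * x.
Proof.
have [D HD] := class_S_log_bounded; exists (expR D); first exact: expR_gt0.
(* Split off one factor [x]; the remaining power is [expR ((p x - 1) * ln x)], at most [expR D]. *)
move=> x x0; rewrite -{1}[p x](subrK 1).
rewrite powRD; last by rewrite (gt_eqF x0) implybT.
rewrite powRr1 ?(ltW x0)// ler_pM2r//.
by rewrite /powR gt_eqF// ler_expR HD.
Qed.

Lemma class_S_derive_log_bounded : exists Q : R, forall x, 0 < x ->
  x * (`|derive1 p x| * `|ln x|) <= Q.
Proof.
have [d [M0 [C0 [a [[d0 M00 C00 a0] _ pM pC]]]]] := class_S_derive hp.
have Q1 : 0 <= M0 * (d ^+ 2 + 1) by rewrite mulr_ge0 ?addr_ge0 ?sqr_ge0 ?ltW.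
have Q2 : 0 <= C0 * (a^-1 * (1 + (d `^ a) ^- 2)).
  rewrite !mulr_ge0 ?invr_ge0 ?ltW// addr_gt0// invr_gt0 exprn_gt0//.
  exact: powR_gt0.
(* The first summand is the bound for [x <= d], the second for [x > d], where the outer [x] turns
   [x]^ (- 1 - a)[into]x [^ (- a)]. *)
exists (M0 * (d ^+ 2 + 1) + C0 * (a^-1 * (1 + (d `^ a) ^- 2))) => x x0.
have [xd|dx] := leP x d.
  apply: (@le_trans _ _ (M0 * (d ^+ 2 + 1))); last by rewrite lerDl.
  rewrite mulrCA ler_pM// ?mulr_ge0 ?(ltW x0)//; first exact: pM.
  exact: mulr_norm_ln_le.
apply: (@le_trans _ _ (C0 * (a^-1 * (1 + (d `^ a) ^- 2)))).
  apply: (@le_trans _ _ (x * ((C0 * x `^ (- 1 - a)) * `|ln x|))).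
    by rewrite ler_pM2l// ler_wpM2r// pC.
  rewrite (_ : x * _ = C0 * (x `^ (- a) * `|ln x|)); last first.
    rewrite powRD; last by rewrite (gt_eqF x0) implybT.
    rewrite (powRN x 1) powRr1 ?(ltW x0)//.
    by field; rewrite gt_eqF.
  by rewrite ler_pM2l// powRN_norm_ln_le// ltW.
by rewrite lerDr.
Qed.

(** Since [powR] is defined by cases at base 0, the function is written as an exponential, to which
    the chain rule applies directly. *)
Lemma is_derive_powR_class_S (x : R) : 0 < x ->
  is_derive x 1 (fun z => expR (p z * ln z))
    (x `^ p x * (p x * x^-1 + ln x * derive1 p x)).
Proof.
move=> x0; rewrite /powR gt_eqF//.
have dp : is_derive x 1 p (derive1 p x).
  by rewrite derive1E; apply: derivableP; exact: class_S_derivable.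
exact: (is_derive1_comp (is_derive_expR _) (is_deriveM dp (is_derive1_ln x0))).
Qed.

End class_S_theory.

Theorem lemma3p1 (R : realType) (p : R -> R) (hp : class_S p) :
  (exists L : R, 0 < L /\
     forall x y : R, 0 < x -> 0 < y ->
       `|x `^ p x - y `^ p y| <= L * `|x - y|) /\
  (exists K : R, 0 < K /\
     forall x : R, 0 < x -> x `^ p x <= K * (1 + x)).
Proof.
have [E E0 pE] := class_S_powR_le hp; split; last first.
  exists E; split => // x x0; apply: (le_trans (pE _ x0)).
  by rewrite ler_pM2l// lerDr.
have [a a0 pa] := class_S_le hp; have [Q pQ] := class_S_derive_log_bounded hp.
have Q0 : 0 <= Q by apply: le_trans (pQ 1 ltr01); rewrite !mulr_ge0.
exists (E * (1 + a + Q)); split; first by rewrite mulr_gt0//; lra.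
have powE z : 0 < z -> z `^ p z = expR (p z * ln z).
  by move=> z0; rewrite /powR gt_eqF.
move=> x y x0 y0; rewrite !powE//.
apply: (bounded_derive_lipschitz (is_derive_powR_class_S hp)) => // z z0.
rewrite normrM ger0_norm ?powR_ge0//.
(* The factor [z] gained here goes inside the absolute value, where it cancels [z^-1] and supplies
   the weight in [pQ]. *)
apply: (@le_trans _ _ (E * z * `|p z * z^-1 + ln z * derive1 p z|)).
  by rewrite ler_wpM2r// pE.
rewrite -mulrA ler_pM2l// -{1}(gtr0_norm z0) -normrM mulrDr.
rewrite (_ : z * (p z / z) = p z); last by field; rewrite gt_eqF.
apply: (le_trans (ler_normD _ _)); apply: lerD.
  by have := class_S_ge1 hp z0; have := pa z z0 => ? ?; rewrite ger0_norm; lra.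
by apply: le_trans (pQ z z0); rewrite !normrM (gtr0_norm z0) (mulrC `|ln z|).
Qed.
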